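(* For the DAG $A_{m,d}$ of self-attention with standard matrix multiplication, where the input matrices have size $m\times d$, we have $$\mathrm{OPT}_{PRBP}(A_{m,d},r)\ \ge\ \Omega\!\left(\min\left(\frac{m^2\cdot d}{\sqrt r},\ \frac{m^2\cdot d^2}{r}\right)\right),$$ i.e. there is an absolute constant $c>0$ such that $\mathrm{OPT}_{PRBP}(A_{m,d},r)\ge c\cdot\min\left(\frac{m^2 d}{\sqrt r},\frac{m^2d^2}{r}\right)$ for all positive integers $m,d$ and every integer $r\ge 2$.
   Context: Attention DAG $A_{m,d}$ (computing $\mathrm{softmax}(QK^T)V$ for $m\times d$ matrices $Q,K,V$). Indices: $i,j\in[m]$, $l\in[d]$, where $[k]=\{1,\dots,k\}$. Matrix multiplication part $Q\cdot K^T$: sources $q_{i,l}$ and $k_{j,l}$ ($2md$ of them); $m^2d$ internal nodes $p_{i,j,l}$, each with incoming edges from $q_{i,l}$ and $k_{j,l}$; $m^2$ root nodes $s_{i,j}$ (entries of $QK^T$), each with incoming edges from the $d$ nodes $p_{i,j,1},\dots,p_{i,j,d}$. Each root $s_{i,j}$ has exactly one outgoing edge, to a node $e_{i,j}$ (exponentiation of $s_{i,j}$) whose only input is $s_{i,j}$. Remaining part: row-sum nodes $t_i$ with inputs $e_{i,1},\dots,e_{i,m}$; further sources $v_{j,l}$; product nodes $f_{i,j,l}$ with inputs $e_{i,j}$ and $v_{j,l}$; sum nodes $g_{i,l}$ with inputs $f_{i,1,l},\dots,f_{i,m,l}$; sinks $o_{i,l}$ with inputs $g_{i,l}$ and $t_i$.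 Partial-computing red-blue pebble game (PRBP, one-shot) on a finite DAG $G=(V,E)$ with fast memory capacity $r$. Sources are nodes of in-degree 0, sinks are nodes of out-degree 0. There are blue, light red and dark red pebbles, and edges can be marked. Initially exactly the sources carry blue pebbles, there are no other pebbles, and all edges are unmarked. Moves: (1) Save: replace a dark red pebble on a node by a blue and a light red pebble. (2) Load: place a light red pebble on a node that has a blue pebble. (3) Partial compute: for an unmarked edge $(u,v)$ such that (i) all incoming edges of $u$ are marked, (ii) $u$ has a (light or dark) red pebble, and (iii) $v$ has a (light or dark) red pebble or no pebble at all, replace all pebbles on $v$ by one dark red pebble and mark $(u,v)$ (each edge is marked at most once and never unmarked). (4) Delete: remove a light red pebble from any node, or remove a dark red pebble from a non-sink node all of whose outgoing edges are marked. At every time the total number of (light and dark) red pebbles is at most $r$. A pebbling is a sequence of moves after which every sink has a blue pebble and every edge is marked. Its cost is the total number of save and load moves, and $\mathrm{OPT}_{PRBP}(G,r)$ is the minimum cost of a pebbling of $G$ with capacity $r$. *)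

(* Defs.v *)
From HB Require Import structures.
From mathcomp Require Import all_boot all_order all_algebra.
From mathcomp Require Import boolp classical_sets reals constructive_ereal ereal.

Set Implicit Arguments.
Unset Strict Implicit.
Unset Printing Implicit Defensive.

Import Order.TTheory GRing.Theory Num.Theory.

Local Open Scope set_scope.

Record dag := Dag {
  node :> finType;
  edge : rel node;
  dag_acyclic : forall p : seq node, cycle edge p -> p = [::]
}.

Lemma ranked_acyclic (V : finType) (e : rel V) (rank : V -> nat) :
  (forall u v, e u v -> rank u < rank v) ->
  forall p : seq V, cycle e p -> p = [::].
Proof.
move=> e_rank [//|x p] /= exp.
have : path ltn (rank x) (map rank (rcons p x)).
  by rewrite path_map; apply: sub_path exp => u v /e_rank.
move/(order_path_min ltn_trans)/allP/(_ (rank x)).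
by rewrite map_rcons mem_rcons mem_head => /(_ isT); rewrite /= ltnn.
Qed.

Section PRBP.
Variable G : dag.
Implicit Types u v w : G.

Definition is_source v := [forall u, ~~ edge u v].
Definition is_sink v := [forall w, ~~ edge v w].

Record config := Config {
  blue : {set G};
  light : {set G};
  dark : {set G};
  marked : {set G * G}
}.

Implicit Type c : config.

Definition red c := light c :|: dark c.

Definition in_marked c v := [forall u, edge u v ==> ((u, v) \in marked c)].
Definition out_marked c v := [forall w, edge v w ==> ((v, w) \in marked c)].

Inductive move :=
  | save of G
  | load of G
  | partial_compute of G & G
  | delete_light of G
  | delete_dark of G.

Definition legal c (mv : move) : bool :=
  match mv with
  | save v => v \in dark c
  | load v => v \in blue c
  | partial_compute u v =>
      [&& edge u v, (u, v) \notin marked c, in_marked c u, u \in red c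
        & (v \in red c) || (v \notin blue c :|: red c)]
  | delete_light v => v \in light c
  | delete_dark v => [&& v \in dark c, ~~ is_sink v & out_marked c v]
  end.

Definition exec c (mv : move) : config :=
  match mv with
  | save v => Config (v |: blue c) (v |: light c) (dark c :\ v) (marked c)
  | load v => Config (blue c) (v |: light c) (dark c) (marked c)
  | partial_compute u v =>
      Config (blue c :\ v) (light c :\ v) (v |: dark c) ((u, v) |: marked c)
  | delete_light v => Config (blue c) (light c :\ v) (dark c) (marked c)
  | delete_dark v => Config (blue c) (light c) (dark c :\ v) (marked c)
  end.

Definition initial : config :=
  Config [set v | is_source v] finset.set0 finset.set0 finset.set0.

Definition complete c : bool :=
  [forall v, is_sink v ==> (v \in blue c)] &&
  [forall u, forall v, edge u v ==> ((u, v) \in marked c)].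

Definition red_count c := #|light c| + #|dark c|.

Fixpoint playable (r : nat) c (ms : seq move) : bool :=
  (red_count c <= r) &&
  (if ms is mv :: ms' then legal c mv && playable r (exec c mv) ms' else true).

Definition pebbling (r : nat) (ms : seq move) : bool :=
  playable r initial ms && complete (foldl exec initial ms).

Definition is_io (mv : move) : bool :=
  match mv with save _ | load _ => true | _ => false end.

Definition cost (ms : seq move) : nat := count is_io ms.

End PRBP.

(* The costs are natural numbers, so this infimum is a minimum as soon as some
   pebbling exists; it is +oo when there is none. *)
Definition OPT_PRBP (R : realType) (G : dag) (r : nat) : \bar R :=
  ereal_inf (fun x : \bar R =>
    exists2 ms : seq (move G), pebbling r ms & x = ((cost ms)%:R)%:E).

(* Nodes of A_{m,d}: Nq i l is q_{i,l}, Np i j l is p_{i,j,l}, and so on. *)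
Inductive attn_node (m d : nat) :=
  | Nq of 'I_m & 'I_d
  | Nk of 'I_m & 'I_d
  | Nv of 'I_m & 'I_d
  | Np of 'I_m & 'I_m & 'I_d
  | Ns of 'I_m & 'I_m
  | Ne of 'I_m & 'I_m
  | Nt of 'I_m
  | Nf of 'I_m & 'I_m & 'I_d
  | Ng of 'I_m & 'I_d
  | No of 'I_m & 'I_d.

Section AttentionNodes.
Variables m d : nat.

Definition attn_code : Type :=
  ('I_m * 'I_d + ('I_m * 'I_d + ('I_m * 'I_d + ('I_m * 'I_m * 'I_d +
  ('I_m * 'I_m + ('I_m * 'I_m + ('I_m + ('I_m * 'I_m * 'I_d +
  ('I_m * 'I_d + 'I_m * 'I_d)))))))))%type.

Definition attn_encode (x : attn_node m d) : attn_code :=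
  match x with
  | Nq i l => inl (i, l)
  | Nk j l => inr (inl (j, l))
  | Nv j l => inr (inr (inl (j, l)))
  | Np i j l => inr (inr (inr (inl (i, j, l))))
  | Ns i j => inr (inr (inr (inr (inl (i, j)))))
  | Ne i j => inr (inr (inr (inr (inr (inl (i, j))))))
  | Nt i => inr (inr (inr (inr (inr (inr (inl i))))))
  | Nf i j l => inr (inr (inr (inr (inr (inr (inr (inl (i, j, l))))))))
  | Ng i l => inr (inr (inr (inr (inr (inr (inr (inr (inl (i, l)))))))))
  | No i l => inr (inr (inr (inr (inr (inr (inr (inr (inr (i, l)))))))))
  end.

Definition attn_decode (x : attn_code) : attn_node m d :=
  match x with
  | inl (i, l) => Nq i l
  | inr (inl (j, l)) => Nk j l
  | inr (inr (inl (j, l))) => Nv j l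
  | inr (inr (inr (inl (i, j, l)))) => Np i j l
  | inr (inr (inr (inr (inl (i, j))))) => Ns d i j
  | inr (inr (inr (inr (inr (inl (i, j)))))) => Ne d i j
  | inr (inr (inr (inr (inr (inr (inl i)))))) => Nt d i
  | inr (inr (inr (inr (inr (inr (inr (inl (i, j, l)))))))) => Nf i j l
  | inr (inr (inr (inr (inr (inr (inr (inr (inl (i, l))))))))) => Ng i l
  | inr (inr (inr (inr (inr (inr (inr (inr (inr (i, l))))))))) => No i l
  end.

Lemma attn_encodeK : cancel attn_encode attn_decode.
Proof. by case. Qed.

HB.instance Definition _ :=
  Countable.copy (attn_node m d) (can_type attn_encodeK).
HB.instance Definition _ : isFinite (attn_node m d) :=
  CanIsFinite attn_encodeK.

Definition attn_edge : rel (attn_node m d) := fun u v =>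
  match u, v with
  | Nq i l, Np i' _ l' => (i == i') && (l == l')
  | Nk j l, Np _ j' l' => (j == j') && (l == l')
  | Np i j _, Ns i' j' => (i == i') && (j == j')
  | Ns i j, Ne i' j' => (i == i') && (j == j')
  | Ne i _, Nt i' => i == i'
  | Ne i j, Nf i' j' _ => (i == i') && (j == j')
  | Nv j l, Nf _ j' l' => (j == j') && (l == l')
  | Nf i _ l, Ng i' l' => (i == i') && (l == l')
  | Ng i l, No i' l' => (i == i') && (l == l')
  | Nt i, No i' _ => i == i'
  | _, _ => false
  end.

Definition attn_rank (x : attn_node m d) : nat :=
  match x with
  | Nq _ _ | Nk _ _ | Nv _ _ => 0
  | Np _ _ _ => 1
  | Ns _ _ => 2
  | Ne _ _ => 3
  | Nt _ | Nf _ _ _ => 4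
  | Ng _ _ => 5
  | No _ _ => 6
  end.

Lemma attn_edge_rank u v : attn_edge u v -> attn_rank u < attn_rank v.
Proof. by destruct u, v. Qed.

Definition attention_dag : dag :=
  Dag (ranked_acyclic attn_edge_rank).

End AttentionNodes.

(* Main.v *)
(** Cut a pebbling into phases of [r] I/O moves, and let [Y] be the set of
    nodes that are red at an end of a phase or loaded or saved during it, so
    [#|Y| <= 3 r].  Suppose the edge from [p_ijl] to [s_ij] gets marked in the
    phase.  Either [p_ijl] is in [Y], or it was computed from scratch within
    the phase, and then the sources [q_il] and [k_jl] are in [Y].  If [s_ij] is
    not in [Y], then its whole sum was computed and consumed within the phase,
    so all [d] of its incoming edges got marked.  Write [q_i], [k_j], [a_ij]
    for the number of [q_il], [k_jl], [p_ijl] in [Y].  At most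
    [2 a_ij + [s_ij \in Y] sqrt r + q_i k_j (1 / sqrt r + 1 / d)] edges into
    [s_ij] thus get marked, which sums to [O(r sqrt r + r^2 / d)] per phase, out
    of [m^2 d].  A pebbling of cost below [r] loads all [m d] queries, so
    [m d < r], and then [m^2 d^2 / r <= m d] is at most the cost. *)

Require Import Defs.
From mathcomp Require Import all_boot all_order all_algebra.
From mathcomp Require Import reals constructive_ereal ereal.
From mathcomp Require Import ring lra.

Import Order.TTheory GRing.Theory Num.Theory.
Local Open Scope ring_scope.

(** * Invariants of play on an arbitrary DAG *)

Section Pebbling.
Variable G : dag.
Implicit Types (u v w : G) (c : config G) (mv : move G) (ms : seq (move G)).

Local Notation run := (foldl (@exec G)).

(** Invariants of reachable configurations. The third field says that a partial value still needed
    is never lost: it is saved, or held by a dark pebble. *)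
Record consistent c : Prop := Consistent {
  source_blue : forall v, is_source v -> v \in blue c;
  marked_in_marked : forall u v, (u, v) \in marked c -> in_marked c u;
  started_pebbled : forall u v w, (u, v) \in marked c -> edge v w ->
    (v, w) \notin marked c -> (v \in blue c) || (v \in dark c)
}.

Lemma initial_consistent : consistent (initial G).
Proof. by split=> [v|u v|u v w]; rewrite !inE. Qed.

Lemma exec_marked c mv : marked c \subset marked (exec c mv).
Proof. by case: mv => [v|v|u v|v|v] //=; exact: finset.subsetUr. Qed.

Lemma run_marked c ms : marked c \subset marked (run c ms).
Proof.
elim: ms c => [|mv ms IH] c //=.
exact: subset_trans (exec_marked c mv) (IH _).
Qed.

Lemma in_markedP c v :
  reflect (forall u, edge u v -> (u, v) \in marked c) (in_marked c v).
Proof. by apply: (iffP forallP) => H u; have /implyP := H u. Qed.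

Lemma in_marked_mono c c' v :
  marked c \subset marked c' -> in_marked c v -> in_marked c' v.
Proof.
by move=> /subsetP sub /in_markedP cv; apply/in_markedP => u /cv /sub.
Qed.

Lemma exec_consistent c mv : consistent c -> legal c mv -> consistent (exec c mv).
Proof.
move=> [srcB inM stP] leg; split.
- move=> v sv; have := srcB v sv; case: mv leg => [x|x|x y|x|x] //=.
  + by rewrite !inE => _ ->; rewrite orbT.
  (* A computed node has an incoming edge, so no source loses its blue pebble. *)
  + case/and5P=> exy _ _ _ _; rewrite !inE => ->; rewrite andbT.
    by apply: contraTneq sv => ->; apply/forallPn; exists x; rewrite negbK.
- move=> u v uv; apply: (@in_marked_mono c _ _ (exec_marked c mv)).
  case: mv leg uv => [x|x|x y|x|x] //=; try by move=> _ /inM.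
  by case/and5P=> _ _ cx _ _; rewrite !inE => /orP[/eqP[-> _] //|/inM].
- move=> u v w uv vw; case: mv leg uv => [x|x|x y|x|x] //=.
  + move=> _ uv vwN; have /orP[H|H] := stP _ _ _ uv vw vwN; rewrite !inE H ?orbT //.
    by case: (v == x); rewrite ?orbT.
  + by move=> _ uv vwN; exact: stP uv vw vwN.
  + case/and5P=> _ _ _ _ _; rewrite !inE negb_or => /orP[/eqP[_ ->]|uv] /andP[_ vwN].
      by rewrite !eqxx.
    by have /orP[->|->] := stP _ _ _ uv vw vwN; rewrite ?orbT //; case: (v == y).
  + by move=> _ uv vwN; exact: stP uv vw vwN.
  + case/and3P=> _ _ /forallP out uv vwN; rewrite !inE.
    have /orP[->//|->] := stP _ _ _ uv vw vwN; rewrite andbT.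
    case: eqP => [vx|]; last by rewrite orbT.
    by have := out w; rewrite -vx vw (negPf vwN).
Qed.

Lemma playable_cat r c ms1 ms2 : playable r c (ms1 ++ ms2) ->
  playable r c ms1 /\ playable r (run c ms1) ms2.
Proof.
elim: ms1 c => [|mv ms IH] c /=.
  by move=> H; split=> //; case: ms2 H => [|? ?] /= /andP[->].
by move=> /and3P[-> -> /IH].
Qed.

Lemma playable_red c r ms : playable r c ms ->
  (#|red c| <= r)%N /\ (#|red (run c ms)| <= r)%N.
Proof.
have redE c' : (#|red c'| <= red_count c')%N.
  by rewrite /red cardsU leq_subr.
elim: ms c => [|mv ms IH] c /=.
  by rewrite andbT => cr; have := leq_trans (redE c) cr.
by case/and3P=> /(leq_trans (redE c)) cr _ /IH[].
Qed.

Lemma run_consistent r c ms :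
  consistent c -> playable r c ms -> consistent (run c ms).
Proof.
elim: ms c => [|mv ms IH] c cc //= /and3P[_ leg]; apply: IH.
exact: exec_consistent.
Qed.

Definition io_nodes ms : seq G :=
  pmap (fun mv => match mv with save v | load v => Some v | _ => None end) ms.

Lemma size_io_nodes ms : size (io_nodes ms) = cost ms.
Proof. by rewrite size_pmap; apply: eq_count; case. Qed.

(** Computing into [v] needs it red or bare, computing out of it needs it red, and only a load turns
    a blue, non-red node red. So without I/O at [v] no edge at [v] gets marked. *)
Lemma blue_stays_unused r c ms v : playable r c ms ->
  v \in blue c -> v \notin red c -> v \notin io_nodes ms ->
  forall u w, ((u, v) \in marked (run c ms) -> (u, v) \in marked c) /\
              ((v, w) \in marked (run c ms) -> (v, w) \in marked c).
Proof.
elim: ms c => [|mv ms IH] c //=.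
case/and3P=> _ leg play vb vr vio u w.
have [vb' [vr' [vio' [uvM vwM]]]] : v \in blue (exec c mv) /\
    v \notin red (exec c mv) /\ v \notin io_nodes ms /\
    ((u, v) \in marked (exec c mv) -> (u, v) \in marked c) /\
    ((v, w) \in marked (exec c mv) -> (v, w) \in marked c).
  move: vr leg vio; rewrite !inE negb_or => /andP[vl vd].
  case: mv {play} => [x|x|x y|x|x] /=; rewrite ?inE /= ?negb_or.
  + by move=> _ /andP[-> ->]; rewrite vb vl (negPf vd) !andbF orbT.
  + by move=> _ /andP[/negPf-> ->]; rewrite vb vl vd.
  + case/and5P=> _ _ _ xr yr vio.
    have vx : v == x = false.
      by apply: contraTF xr => /eqP<-; rewrite (negPf vl) (negPf vd).
    have vy : v == y = false.
      apply: contraTF yr => /eqP<-.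
      by rewrite (negPf vl) (negPf vd) vb.
    by rewrite vy vb (negPf vl) (negPf vd) !xpair_eqE vx vy !andbF.
  + by move=> _ ->; rewrite vb (negPf vl) vd andbF.
  + by move=> _ ->; rewrite vb vl (negPf vd) andbF.
have [H1 H2] := IH _ play vb' vr' vio' u w.
by split=> [/H1|/H2].
Qed.

(** Without a save, a dark pebble leaves [v] only by deletion, which needs [(v, w)] marked and
    hence, by consistency, every edge into [v] marked. *)
Lemma dark_stays_unless_done r c ms v w : consistent c -> playable r c ms ->
  edge v w -> v \in dark c -> v \notin io_nodes ms ->
  v \in dark (run c ms) \/ in_marked (run c ms) v.
Proof.
move=> cc play vw vd; elim: ms c cc play vd => [|mv ms IH] c cc /=; first by left.
case/and3P=> _ leg play vd vio.
have cc' := exec_consistent _ _ cc leg.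
have [vd'|done] : v \in dark (exec c mv) \/ in_marked c v.
  case: mv leg vio {play cc'} => [x|x|x y|x|x] /=; rewrite ?inE; try by left.
  + by move=> _; rewrite negb_or => /andP[->]; left.
  + by left; rewrite vd orbT.
  + case/and3P=> _ _ /forallP out _; have [vx|] := eqVneq v x; last by left.
    by right; apply: (marked_in_marked _ cc _ w); have := out w; rewrite -vx vw.
- by apply: IH => //; case: mv vio {leg play cc' vd'} => //= x; rewrite inE negb_or => /andP[].
- right; apply: in_marked_mono done.
  exact: subset_trans (exec_marked c mv) (run_marked _ _).
Qed.

Definition newly_marked c c' (e : G * G) := (e \in marked c') && (e \notin marked c).

Lemma run_newly_marked r c ms u v : consistent c -> playable r c ms ->
  newly_marked c (run c ms) (u, v) ->
  exists ms1 ms2, [/\ ms = ms1 ++ partial_compute u v :: ms2,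
    legal (run c ms1) (partial_compute u v) & consistent (run c ms1)].
Proof.
rewrite /newly_marked; elim: ms c => [|mv ms IH] c cc /=; first by move=> _ /andP[->].
case/and3P=> _ leg play /andP[uvM uvN].
have cc' := exec_consistent _ _ cc leg.
have [uv'|uv'] := boolP ((u, v) \in marked (exec c mv)).
  case: mv leg uv' {play cc' uvM} => [x|x|x y|x|x] leg; rewrite /= ?(negPf uvN) //.
  rewrite !inE (negPf uvN) orbF => /eqP[-> ->].
  by exists [::], ms.
have [|ms1 [ms2 [-> leg1 cc1]]] := IH _ cc' play; first by rewrite uvM.
by exists (mv :: ms1), ms2.
Qed.

(** * Edges marked within one phase *)

Section Phase.
Variables (r : nat) (c : config G) (ms : seq (move G)).
Hypotheses (cc : consistent c) (play : playable r c ms).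

(** The set [Y] of the overview, for the phase [ms] started in [c]. *)
Definition active : {set G} :=
  red c :|: red (run c ms) :|: [set v | v \in io_nodes ms].

Lemma card_active : (#|active| <= r + r + cost ms)%N.
Proof.
have [r1 r2] := playable_red _ _ _ play.
have cardU (A B : {set G}) : (#|A :|: B| <= #|A| + #|B|)%N.
  by rewrite cardsU leq_subr.
apply: leq_trans (cardU _ _) _; rewrite leq_add //.
  by apply: leq_trans (cardU _ _) _; rewrite leq_add.
by rewrite cardsE -size_io_nodes card_size.
Qed.

Lemma newly_marked_edge u v :
  newly_marked c (run c ms) (u, v) -> edge u v.
Proof. by case/(run_newly_marked _ _ _ _ _ cc play)=> ? [? [_ /and5P[]]]. Qed.

Lemma newly_marked_source_active u v : is_source u ->
  newly_marked c (run c ms) (u, v) -> u \in active.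
Proof.
move=> su /andP[uvM uvN]; apply: contraNT uvN.
rewrite !inE -!orbA !negb_or => /and5P[ul ud _ _ uio].
have [||_ ->] // := blue_stays_unused _ _ _ u play _ _ uio u v.
- exact: source_blue.
- by rewrite !inE negb_or ul ud.
Qed.

(** Marking [(u, v)] requires all edges into [u] to be marked. Had [(x, u)] been marked before the
    phase, then [u], still owing [(u, v)], would start blue or dark; being inactive, it would be
    blue and not red, and none of its edges could get marked. *)
Lemma newly_marked_tail u v x : u \notin active ->
  newly_marked c (run c ms) (u, v) -> edge x u ->
  newly_marked c (run c ms) (x, u).
Proof.
move=> uY uvn xu; have uv := newly_marked_edge _ _ uvn.
move: uY; rewrite !inE -!orbA !negb_or => /and5P[ul ud _ _ uio].
have [ms1 [ms2 [msE leg _]]] := run_newly_marked _ _ _ _ _ cc play uvn.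
case/and5P: leg => _ _ /in_markedP/(_ _ xu) xuM _ _.
apply/andP; split.
  by move: xuM; apply/subsetP; rewrite msE foldl_cat run_marked.
move: uvn => /andP[uvM uvN]; apply: contra uvN => xuc.
apply/negPn/negP => uvN; case/negP: (uvN).
have [||_ ->] // := blue_stays_unused _ _ _ u play _ _ uio u v.
- by have := started_pebbled _ cc _ _ _ xuc uv uvN; rewrite (negPf ud) orbF.
- by rewrite !inE negb_or ul ud.
Qed.

(** Once [(u, v)] is marked, [v] is dark; it sees no I/O and is not red at the end, so by then all
    its incoming edges are marked. Had one been marked before the phase, [v] would start blue and
    not red, and [(u, v)] could not get marked. *)
Lemma newly_marked_head u v w x : v \notin active -> edge v w ->
  newly_marked c (run c ms) (u, v) -> edge x v ->
  newly_marked c (run c ms) (x, v).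
Proof.
move=> vY vw uvn xv; have uv := newly_marked_edge _ _ uvn.
move: vY; rewrite !inE -!orbA !negb_or => /and5P[vl vd _ vd' vio].
have [ms1 [ms2 [msE leg cc1]]] := run_newly_marked _ _ _ _ _ cc play uvn.
pose c1 := exec (run c ms1) (partial_compute u v).
have runE : run c ms = run c1 ms2 by rewrite msE foldl_cat.
have play2 : playable r c1 ms2.
  by have := play; rewrite msE => /playable_cat[_ /and3P[]].
have vio2 : v \notin io_nodes ms2.
  apply: contra vio; rewrite msE /io_nodes pmap_cat mem_cat => H.
  by apply/orP; right.
have vd1 : v \in dark c1 by rewrite !inE eqxx.
have [|/in_markedP/(_ _ xv) xvM] :=
    dark_stays_unless_done _ _ _ _ _ (exec_consistent _ _ cc1 leg) play2 vw vd1 vio2.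
  by rewrite -runE (negPf vd').
rewrite -runE in xvM; rewrite /newly_marked xvM; apply/negP => xvc.
case/andP: uvn => uvM uvN.
(* No edge out of [v] can be marked while [(u, v)] is not. *)
have vwN : (v, w) \notin marked c.
  by apply: contra uvN => /(marked_in_marked _ cc)/in_markedP/(_ _ uv).
case/negP: uvN.
have [||uvc _] := blue_stays_unused _ _ _ v play _ _ vio u v.
- by have := started_pebbled _ cc _ _ _ xvc vw vwN; rewrite (negPf vd) orbF.
- by rewrite !inE negb_or vl vd.
- exact: uvc.
Qed.

End Phase.
End Pebbling.

(** * Cutting a run by cost, and elementary counting *)

Lemma split_cost (G : dag) (ms : seq (move G)) n : (n <= cost ms)%N ->
  exists ms1 ms2, ms = ms1 ++ ms2 /\ cost ms1 = n.
Proof.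
elim: ms n => [|mv ms IH] n; first by rewrite leqn0 => /eqP->; exists [::], [::].
case: n => [|n] /= le_n; first by exists [::], (mv :: ms).
(* Subtracting [is_io mv] treats both kinds of move at once: only an I/O move uses up a unit. *)
have [|ms1 [ms2 [-> cost1]]] := IH (n.+1 - is_io mv)%N; first by rewrite leq_subLR.
exists (mv :: ms1), ms2; split=> //=.
by rewrite -[LHS]/(is_io mv + cost ms1)%N cost1 subnKC //; case: is_io.
Qed.

Lemma sum_mem_inj (I T : finType) (f : I -> T) (Y : {set T}) :
  injective f -> (\sum_x (f x \in Y) <= #|Y|)%N.
Proof.
move=> f_inj; have -> : (\sum_x (f x \in Y))%N = #|f @^-1: Y|.
  by rewrite -sum1_card [RHS]big_mkcond; apply: eq_bigr => x _; rewrite inE; case: ifP.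
rewrite -(card_imset _ f_inj); apply: subset_leq_card.
by apply/subsetP => y /imsetP[x]; rewrite inE => fxY ->.
Qed.

(* Both cases are the inequality (n - x)^2 >= 0, with x = s if b holds and
   x = d otherwise. *)
Lemma pair_count_bound (R : realFieldType) (d T a n q k : nat) (b : bool) (s : R) :
  0 < s -> (0 < d)%N -> (T <= a + n)%N -> (n <= q)%N -> (n <= k)%N ->
  (~~ b -> (0 < T)%N -> T = d) ->
  T%:R <= 2 * a%:R + b%:R * s + q%:R * k%:R * (s^-1 + d%:R^-1).
Proof.
move=> s0 d0 Tan nq nk Td.
have dR : 0 < d%:R :> R by rewrite ltr0n.
have nn : n%:R ^+ 2 <= q%:R * k%:R :> R.
  by rewrite -natrX -natrM ler_nat expnS expn1 leq_mul.
have TR : T%:R <= a%:R + n%:R :> R by rewrite -natrD ler_nat.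
have amgm (x : R) : 0 < x -> 2 * n%:R <= x + q%:R * k%:R * x^-1.
  move=> x0; rewrite -(ler_pM2r x0) [leRHS]mulrDl mulfVK ?gt_eqF //.
  by have := sqr_ge0 (n%:R - x); nra.
have a0 : 0 <= a%:R :> R by [].
have qkV (x : R) : 0 < x -> 0 <= q%:R * k%:R * x^-1.
  by move=> x0; rewrite !mulr_ge0 // invr_ge0 ltW.
have := amgm _ s0; have := amgm _ dR; have := qkV _ s0; have := qkV _ dR.
have n0 : 0 <= n%:R :> R by [].
rewrite mulrDr; case: b Td => /= Td.
  by rewrite mul1r; lra.
have [->|T0] := posnP T; first by lra.
by move: TR; rewrite (Td isT T0); lra.
Qed.

(** * Progress of one phase on the attention DAG *)

Section Attention.
Variables (m d : nat).
Local Notation A := (attention_dag m d).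

Definition product_edge (x : 'I_m * 'I_m * 'I_d) : A * A :=
  let: (i, j, l) := x in (Np i j l, Ns d i j).

(** The progress measure: a complete pebbling raises it from 0 to m^2 d. *)
Definition products (c : config A) : nat :=
  \sum_i \sum_j \sum_l (product_edge (i, j, l) \in marked c).

Lemma Nq_source i l : is_source (Nq i l : A).
Proof. by apply/forallP; case. Qed.

Lemma Nk_source j l : is_source (Nk j l : A).
Proof. by apply/forallP; case. Qed.

Section AttentionPhase.
Variables (r : nat) (c : config A) (ms : seq (move A)).
Hypotheses (cc : consistent _ c) (play : playable r c ms).
Let c' := foldl (@exec A) c ms.
Let Y := active A c ms.
Let new i j l := newly_marked A c c' (product_edge (i, j, l)).

Lemma new_product_active i j l : new i j l ->
  (Np i j l : A) \notin Y -> ((Nq i l : A) \in Y) && ((Nk j l : A) \in Y).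
Proof.
move=> newx xY; apply/andP; split.
  apply: (newly_marked_source_active _ _ _ _ cc play _ (Np i j l)).
    exact: Nq_source.
  by apply: (newly_marked_tail _ _ _ _ cc play _ _ _ xY newx); rewrite /= !eqxx.
apply: (newly_marked_source_active _ _ _ _ cc play _ (Np i j l)).
  exact: Nk_source.
by apply: (newly_marked_tail _ _ _ _ cc play _ _ _ xY newx); rewrite /= !eqxx.
Qed.

(** The edge from [Ns d i j] to [Ne d i j] is the outgoing edge that [newly_marked_head] asks
    for. *)
Lemma new_score_complete i j l l' : new i j l ->
  (Ns d i j : A) \notin Y -> new i j l'.
Proof.
move=> newx sY.
by apply: (newly_marked_head _ _ _ _ cc play _ _ (Ne d i j) _ sY _ newx);
  rewrite /= !eqxx.
Qed.

(** With [#|Y|] at most 3 r and s = sqrt r, summing [pair_count_bound] over all pairs gives 6 r + 3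
    r s + 9 r^2 (1/s + 1/d). As r <= r s and r^2 / s = r s, this is at most 18 r s + 9 r^2 / d. *)
Lemma phase_products (R : rcfType) : (0 < r)%N -> (0 < d)%N -> (cost ms <= r)%N ->
  (products c')%:R <= (products c)%:R +
    (18 * (r%:R * Num.sqrt r%:R) + 9 * (r%:R ^+ 2 / d%:R)) :> R.
Proof.
move=> r0 d0 costr; set s : R := Num.sqrt r%:R.
have rR : 0 < r%:R :> R by rewrite ltr0n.
have s0 : 0 < s by rewrite sqrtr_gt0.
have ss : s * s = r%:R by rewrite -expr2 sqr_sqrtr ?ltW.
have s1 : 1 <= s by rewrite -sqrtr1 ler_wsqrtr // ler1n.
pose T i j := (\sum_l new i j l)%N.
pose a i j := (\sum_l ((Np i j l : A) \in Y))%N.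
pose q i := (\sum_l ((Nq i l : A) \in Y))%N.
pose k j := (\sum_l ((Nk j l : A) \in Y))%N.
have YR : #|Y|%:R <= 3 * r%:R :> R.
  rewrite -natrM ler_nat; apply: leq_trans (card_active _ _ _ _ play) _.
  by rewrite !mulSn mul0n addn0 addnA leq_add2l.
have prodE : (products c' <= products c + \sum_i \sum_j T i j)%N.
  rewrite /products -big_split; apply: leq_sum => i _ /=.
  rewrite -big_split; apply: leq_sum => j _ /=.
  rewrite -big_split; apply: leq_sum => l _ /=.
  by rewrite /new /newly_marked; do 2 case: (_ \in _).
have Tbound i j : (T i j)%:R <= 2 * (a i j)%:R + ((Ns d i j : A) \in Y)%:R * s
    + (q i)%:R * (k j)%:R * (s^-1 + d%:R^-1).
  (* Here [n] counts the l for which both sources are active; a new edge has an active tail or is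
     counted there. *)
  apply: (@pair_count_bound _ _ _ _
    (\sum_l (((Nq i l : A) \in Y) && ((Nk j l : A) \in Y)))%N) => //.
  - rewrite -big_split; apply: leq_sum => l _ /=.
    have [newx|//] := boolP (new i j l).
    have [//|/(new_product_active _ _ _ newx)->] := boolP ((Np i j l : A) \in Y).
    by rewrite addn1.
  - by apply: leq_sum => l _; case: (_ \in _); case: (_ \in _).
  - by apply: leq_sum => l _; case: (_ \in _); case: (_ \in _).
  - move=> sY; rewrite lt0n sum_nat_eq0 => /forallPn[l]; rewrite eqb0 negbK => newx.
    rewrite /T (eq_bigr (fun=> 1%N)) ?sum1_card ?card_ord // => l' _.
    by rewrite (new_score_complete _ _ _ l' newx sY).
have aY : (\sum_i \sum_j a i j <= #|Y|)%N.
  rewrite pair_bigA pair_bigA /=.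
  by apply: (@sum_mem_inj _ _ (fun x : 'I_m * 'I_m * 'I_d => Np x.1.1 x.1.2 x.2))
    => -[[? ?] ?] [[? ?] ?] /= [-> -> ->].
have sY : (\sum_i \sum_j ((Ns d i j : A) \in Y) <= #|Y|)%N.
  rewrite pair_bigA /=.
  by apply: (@sum_mem_inj _ _ (fun x : 'I_m * 'I_m => Ns d x.1 x.2))
    => -[? ?] [? ?] /= [-> ->].
have qY : (\sum_i q i <= #|Y|)%N.
  rewrite pair_bigA /=.
  by apply: (@sum_mem_inj _ _ (fun x : 'I_m * 'I_d => Nq x.1 x.2))
    => -[? ?] [? ?] /= [-> ->].
have kY : (\sum_j k j <= #|Y|)%N.
  rewrite pair_bigA /=.
  by apply: (@sum_mem_inj _ _ (fun x : 'I_m * 'I_d => Nk x.1 x.2))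
    => -[? ?] [? ?] /= [-> ->].
have toR n : (n <= #|Y|)%N -> n%:R <= 3 * r%:R :> R.
  by move=> nY; apply: le_trans YR; rewrite ler_nat.
have {}prodE : (products c')%:R <= (products c)%:R
    + \sum_i \sum_j (T i j)%:R :> R.
  move: prodE; rewrite -(ler_nat R) natrD natr_sum.
  by under eq_bigr do rewrite natr_sum.
apply: le_trans prodE _; rewrite lerD2l.
(* The sum of q_i k_j over all pairs factors into two sums, each at most [#|Y|]. *)
apply: (@le_trans _ _ (2 * (\sum_i \sum_j a i j)%N%:R
    + (\sum_i \sum_j ((Ns d i j : A) \in Y))%N%:R * s
    + (\sum_i q i)%N%:R * (\sum_j k j)%N%:R * (s^-1 + d%:R^-1))).
  rewrite !natr_sum mulr_sumr mulr_suml mulr_suml mulr_suml -!big_split /=.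
  apply: ler_sum => i _; move: (q i) (Tbound i) => qi Ti.
  rewrite !natr_sum mulr_sumr mulr_suml mulr_sumr mulr_suml -!big_split /=.
  by apply: ler_sum => j _; exact: Ti.
have {}aY := toR _ aY; have {}sY := toR _ sY.
have {}qY := toR _ qY; have {}kY := toR _ kY.
have qk := ler_pM (ler0n _ _) (ler0n _ _) qY kY.
have w0 : 0 <= s^-1 + d%:R^-1 by rewrite addr_ge0 // invr_ge0 ?ltW.
have {}qk := ler_wpM2r w0 qk.
have {}sY := ler_wpM2r (ltW s0) sY.
have rsV : r%:R / s = s by rewrite -ss mulfK ?gt_eqF.
have rs := ler_wpM2l (ltW rR) s1.
have -> : 9 * (r%:R ^+ 2 / d%:R) = 3 * r%:R * (3 * r%:R) * (s^-1 + d%:R^-1)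
    - 9 * (r%:R * s).
  by rewrite -{2}rsV; ring.
lra.
Qed.
End AttentionPhase.

(** * From one phase to a whole pebbling *)

Lemma products_bound (R : rcfType) r c ms : consistent _ c -> playable r c ms ->
  (0 < r)%N -> (0 < d)%N ->
  (products (foldl (@exec A) c ms))%:R <= (products c)%:R +
    ((cost ms)%:R / r%:R + 1) *
    (18 * (r%:R * Num.sqrt r%:R) + 9 * (r%:R ^+ 2 / d%:R)) :> R.
Proof.
move=> cc play r0 d0.
(* Strong induction on the cost: a run of cost above r is cut after r I/O moves, and this first
   phase accounts for one unit of [cost / r]. *)
have [n] := ubnP (cost ms); elim: n => // n IH in c ms cc play *.
have rR : 0 < r%:R :> R by rewrite ltr0n.
set F := 18 * _ + _.
have F0 : 0 <= F by rewrite !addr_ge0 ?mulr_ge0 ?sqrtr_ge0 ?exprn_ge0 ?invr_ge0.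
rewrite ltnS => costn.
have [small|big] := leqP (cost ms) r.
  apply: le_trans (phase_products _ _ _ cc play R r0 d0 small) _.
  by rewrite -/F lerD2l [leRHS]mulrDl mul1r lerDr mulr_ge0 // divr_ge0.
have [ms1 [ms2 [msE cost1]]] := split_cost _ _ _ (ltnW big).
have costE : cost ms = (r + cost ms2)%N.
  by rewrite msE /cost count_cat -/(cost ms1) cost1.
have [play1 play2] : playable r c ms1 /\ playable r (foldl (@exec A) c ms1) ms2.
  by apply: playable_cat; rewrite -msE.
have H1 := phase_products _ _ _ cc play1 R r0 d0 (eq_leq cost1).
have cc1 := run_consistent _ _ _ _ cc play1.
have lt2 : (cost ms2 < n)%N.
  by apply: leq_trans costn; rewrite costE -[X in (X < _)%N]add0n ltn_add2r.
have H2 := IH _ _ cc1 play2 lt2.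
rewrite costE msE foldl_cat natrD [_ / r%:R]mulrDl divff ?gt_eqF //.
rewrite -/F in H1 H2.
by lra.
Qed.

Lemma all_products c : complete c -> products c = (m * m * d)%N.
Proof.
case/andP=> _ /forallP all_marked; rewrite /products.
under eq_bigr => i _.
  under eq_bigr => j _.
    under eq_bigr => l _.
      have /forallP/(_ (Ns d i j))/implyP -> := all_marked (Np i j l);
        last by rewrite /= !eqxx.
    over.
    rewrite sum_nat_const card_ord muln1.
  over.
  rewrite sum_nat_const card_ord.
over.
by rewrite sum_nat_const card_ord mulnA.
Qed.

Lemma initial_products : products (initial A) = 0%N.
Proof. by rewrite /products big1 // => i _; rewrite big1 // => j _; rewrite big1 // => l _; rewrite inE. Qed.

(** Each query starts blue and not red, and an edge out of it must get marked, so it occurs in some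
    I/O move; distinct queries are distinct nodes. *)
Lemma queries_loaded r (ms : seq (move A)) : (0 < m)%N -> pebbling r ms -> (m * d <= cost ms)%N.
Proof.
move=> m0 /andP[play /andP[_ /forallP all_marked]].
(* Any column serves to pick an edge out of q_il. *)
pose j0 := Ordinal m0.
have -> : (m * d)%N = #|{: 'I_m * 'I_d}| by rewrite card_prod !card_ord.
rewrite -size_io_nodes.
have inj_q : injective (fun x : 'I_m * 'I_d => Nq x.1 x.2).
  by move=> [? ?] [? ?] /= [-> ->].
rewrite -(card_codom inj_q); apply: leq_trans (card_size _); apply: subset_leq_card.
apply/subsetP => _ /codomP[[i l] ->] /=.
have /forallP/(_ (Np i j0 l))/implyP qpM := all_marked (Nq i l).
have {qpM}qpM := qpM (introT andP (conj (eqxx i) (eqxx l))).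
apply: contraT => qio.
have [||_ H] := blue_stays_unused A r (initial A) ms (Nq i l) play _ _ qio (Nq i l) (Np i j0 l).
- by rewrite inE Nq_source.
- by rewrite !inE.
- by have := H qpM; rewrite inE.
Qed.

End Attention.

(** * The lower bound on the optimal cost *)

Theorem theorem6p11 (R : realType) :
  exists c : R, 0 < c /\
    forall m d r : nat, (0 < m)%N -> (0 < d)%N -> (2 <= r)%N ->
      ((c * Num.min (m%:R ^+ 2 * d%:R / Num.sqrt r%:R)
                    (m%:R ^+ 2 * d%:R ^+ 2 / r%:R))%:E
        <= OPT_PRBP R (attention_dag m d) r)%E.
Proof.
(* 54 = 36 + 18: when K >= r, the factor K/r + 1 is at most 2K/r, which turns the phase bound 18 r s
   + 9 r^2 / d into K (36 s + 18 r / d). *)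
exists 54^-1; split=> [|m d r m0 d0 r2]; first by rewrite invr_gt0.
apply: le_ereal_inf_tmp => _ [ms peb ->]; rewrite lee_fin.
have r0 := ltnW r2.
have rR : 0 < r%:R :> R by rewrite ltr0n.
have dR : 0 < d%:R :> R by rewrite ltr0n.
set s : R := Num.sqrt r%:R.
have s0 : 0 < s by rewrite sqrtr_gt0.
have ss : s * s = r%:R by rewrite -expr2 sqr_sqrtr ?ltW.
set M : R := Num.min _ _.
have M0 : 0 <= M.
  by rewrite le_min !mulr_ge0 ?invr_ge0 ?exprn_ge0 // ltW.
have Ms : M * s <= m%:R ^+ 2 * d%:R.
  by rewrite -ler_pdivlMr // ge_min lexx.
have Mr : M * r%:R <= m%:R ^+ 2 * d%:R ^+ 2.
  by rewrite -ler_pdivlMr // ge_min lexx orbT.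
rewrite mulrC ler_pdivrMr //.
have := queries_loaded _ _ _ _ m0 peb; rewrite -(ler_nat R) natrM => mdK.
case/andP: peb => play fin.
set K : R := (cost ms)%:R in mdK *.
have md0 : 0 < m%:R * d%:R :> R by rewrite mulr_gt0 // ltr0n.
have [Kr|rK] := ltP K r%:R.
  (* Low cost: M r <= (m d)^2 <= K^2 <= K r. *)
  rewrite -(ler_pM2r rR); apply: le_trans Mr _.
  by rewrite -exprMn expr2; nra.
have := products_bound m d R r _ ms (initial_consistent _) play r0 d0.
rewrite (all_products _ _ _ fin) initial_products add0r -/K -/s !natrM.
set N : R := m%:R * m%:R * d%:R => bound.
have rV : 1 <= K / r%:R by rewrite ler_pdivlMr // mul1r.
have N0 : 0 < N by rewrite !mulr_gt0 // ltr0n.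
have {}bound : N <= K * (36 * s + 18 * (r%:R / d%:R)).
  apply: le_trans bound _.
  have -> : K * (36 * s + 18 * (r%:R / d%:R)) =
      (K / r%:R + K / r%:R) * (18 * (r%:R * s) + 9 * (r%:R ^+ 2 / d%:R)).
    by field; rewrite !gt_eqF.
  rewrite ler_wpM2r ?lerD2l // addr_ge0 ?mulr_ge0 ?exprn_ge0 ?invr_ge0 //; exact: ltW.
(* After multiplication by N = m^2 d, [bound] applies, and the two arguments of the minimum give M s
   <= N and M r / d <= N. *)
rewrite -(ler_pM2l N0).
have K0 : 0 <= K by rewrite (le_trans (ltW rR)).
apply: (@le_trans _ _ (M * (K * (36 * s + 18 * (r%:R / d%:R))))).
  by rewrite mulrC ler_wpM2l.
have Mrd : M * (r%:R / d%:R) <= N.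
  by rewrite mulrA ler_pdivrMr // (le_trans Mr) // /N; lra.
have {}Ms : M * s <= N by rewrite (le_trans Ms) // /N expr2.
have -> : M * (K * (36 * s + 18 * (r%:R / d%:R))) =
    K * (36 * (M * s) + 18 * (M * (r%:R / d%:R))) by ring.
rewrite [leRHS]mulrCA ler_wpM2l //; lra.
Qed.
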